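(* Fix $K\in[n]$, $0<\theta<1$, and real numbers $w_1\geq w_2\geq\cdots\geq w_n\geq 0$ with $\sum_{i=1}^n w_i=1$. Let $S=\{x\in\{0,1\}^n: w\cdot x\geq\theta\}$. Then there is a vector $v=(v_1,\dots,v_n)\in\mathbb{R}^n$ such that (a) $\sum_{i=1}^n v_i=1$ and $v_1\geq\cdots\geq v_n\geq 0$; (b) every $x\in S$ satisfies $v\cdot x\geq\theta$; and (c) either $v_{K+1}=\cdots=v_n=0$, or else $\sum_{i=1}^K v_i\leq (K+2)^{(K+2)/2}\cdot\sum_{i=K+1}^n v_i$. *)

(* Defs.v *)
From HB Require Import structures.
From mathcomp Require Import all_boot all_order all_algebra.
From mathcomp Require Import reals exp.

Set Implicit Arguments.
Unset Strict Implicit.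
Unset Printing Implicit Defensive.

Import Order.TTheory GRing.Theory Num.Theory.
Local Open Scope ring_scope.

Definition dotb (R : realType) (n : nat) (w : 'rV[R]_n)
    (x : {ffun 'I_n -> bool}) : R :=
  \sum_(i < n) w ord0 i * (x i)%:R.

Definition halfspace (R : realType) (n : nat) (w : 'rV[R]_n) (theta : R) :
    {set {ffun 'I_n -> bool}} :=
  [set x | theta <= dotb w x].

Definition nonincreasing_ge0 (R : realType) (n : nat) (a : 'rV[R]_n) : Prop :=
  (forall i j : 'I_n, (i <= j)%N -> a ord0 j <= a ord0 i) /\
  (forall i : 'I_n, 0 <= a ord0 i).

(* Main.v *)
(* Keep the proportions of the tail [w_{K+1}, ..., w_n] fixed, so that the
   unknowns are the head [h], the tail mass [s] and the threshold [theta'], and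
   maximise [theta'] among all [z = (s, theta', h)] of total mass 1 that satisfy
   every inequality [a . v >= b . v + c theta'], for 0/1 vectors [a], [b] and a bit
   [c], that [w] satisfies with [theta]. At a vertex, [K+1] independent
   homogeneous inequalities are tight, and Cramer's rule writes
   [(sum h) / s] as a quotient of determinants. The denominator omits the column
   of [s], the only column with non-integral entries, so it is a nonzero
   integer; the numerator has size [K+2] and entries in [-1, 1], so Hadamard's
   inequality bounds it. *)

Require Import Defs.
From HB Require Import structures.
From mathcomp Require Import all_boot all_order all_algebra.
From mathcomp Require Import reals exp.
From mathcomp Require Import boolp ring.
Set Implicit Arguments.
Unset Strict Implicit.
Unset Printing Implicit Defensive.

Import Order.TTheory GRing.Theory Num.Theory.
Local Open Scope ring_scope.

(** * Gram determinants and Hadamard's inequality *)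

Lemma gram_rowE (R : realFieldType) n (u : 'rV[R]_n) :
  (u *m u^T) 0 0 = \sum_j u 0 j ^+ 2.
Proof. by rewrite mxE; apply: eq_bigr => j _; rewrite mxE expr2. Qed.

Lemma gram_row_ge0 (R : realFieldType) n (u : 'rV[R]_n) : 0 <= (u *m u^T) 0 0.
Proof. by rewrite gram_rowE sumr_ge0 // => j _; rewrite sqr_ge0. Qed.

Lemma gram_row_eq0 (R : realFieldType) n (u : 'rV[R]_n) : u *m u^T = 0 -> u = 0.
Proof.
move=> u0; apply/rowP => j; rewrite mxE.
have /eqP := gram_rowE u; rewrite u0 mxE eq_sym.
rewrite psumr_eq0 => [|k _]; last exact: sqr_ge0.
by move=> /allP/(_ j (mem_index_enum j)); rewrite /= sqrf_eq0 => /eqP.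
Qed.

(** Induction on the rows: subtracting from the first row its projection on the others keeps the
    Gram determinant, which then factors, and does not lengthen that row. [B] is rectangular because
    each step drops a row but no column. *)
Lemma det_gram_bounds (R : realFieldType) k n (B : 'M[R]_(k, n)) :
  0 <= \det (B *m B^T) <= \prod_i \sum_j B i j ^+ 2.
Proof.
elim: k B => [|k IHk] B; first by rewrite det_mx00 big_ord0 ler01 lexx.
rewrite -[B](@vsubmxK _ 1 k); set u := usubmx _; set C := dsubmx _.
rewrite big_ord_recl.
have -> : \sum_j (@col_mx _ 1 k n u C) ord0 j ^+ 2 = (u *m u^T) 0 0.
  rewrite gram_rowE; apply: eq_bigr => j _.
  by rewrite (_ : ord0 = lshift k (0 : 'I_1)) ?col_mxEu //; exact: val_inj.
have -> : \prod_i (\sum_j (@col_mx _ 1 k n u C) (lift ord0 i) j ^+ 2)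
   = \prod_i \sum_j C i j ^+ 2.
  apply: eq_bigr => i _; apply: eq_bigr => j _.
  by rewrite -rshift1 col_mxEd.
have /andP[C_ge0 C_le] := IHk C.
have prod_ge0 : 0 <= (u *m u^T) 0 0 * \prod_i \sum_j C i j ^+ 2.
  by rewrite mulr_ge0 ?gram_row_ge0 // (le_trans C_ge0).
have [C0|C_neq0] := eqVneq (\det (C *m C^T)) 0.
  suff -> : \det (col_mx u C *m (col_mx u C)^T) = 0 by rewrite lexx.
  (* If [y] kills [C *m C^T], then [y *m C] has norm zero, so the rows of [C], hence those of the
     whole matrix, are dependent. *)
  have /det0P[y y_neq0 yCC] : \det (C *m C^T) == 0 by rewrite C0.
  have yC : y *m C = 0.
    by apply: gram_row_eq0; rewrite trmx_mul mulmxA -(mulmxA y) yCC mul0mx.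
  apply/eqP/det0P; exists (row_mx (0 : 'M_1) y).
    apply: contra_neq y_neq0 => /(congr1 (@rsubmx _ 1 1 k)).
    by rewrite row_mxKr linear0.
  by rewrite mulmxA mul_row_col yC mul0mx addr0 mul0mx.
have C_unit : C *m C^T \in unitmx by rewrite unitmxE unitfE.
(* [p *m C] is the orthogonal projection of [u] on the row space of [C], and [q] is the
   remainder. *)
pose p := u *m C^T *m invmx (C *m C^T).
pose q := u - p *m C.
have qC : q *m C^T = 0.
  by rewrite mulmxBl -!mulmxA mulVmx // mulmx1 subrr.
have Cq : C *m q^T = 0 by rewrite -[LHS]trmxK trmx_mul trmxK qC trmx0.
have defB : col_mx u C = block_mx 1%:M p 0 1%:M *m col_mx q C.
  by rewrite mul_block_col !mul1mx mul0mx add0r subrK.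
have -> : \det (col_mx u C *m (col_mx u C)^T)
          = (q *m q^T) 0 0 * \det (C *m C^T).
  rewrite defB trmx_mul mulmxA -(mulmxA (block_mx _ _ _ _)) !det_mulmx det_tr.
  rewrite det_ublock !det1 !mulr1 !mul1r tr_col_mx mul_col_row qC Cq det_ublock.
  by rewrite det_mx11.
(* Pythagoras. *)
have -> : (u *m u^T) 0 0 = (q *m q^T) 0 0 + (p *m C *m (p *m C)^T) 0 0.
  rewrite -[u](subrK (p *m C)) -/q linearD /= mulmxDl !mulmxDr.
  rewrite trmx_mul !mulmxA qC mul0mx addr0 -(mulmxA p C) Cq mulmx0 add0r.
  by rewrite mxE.
rewrite mulr_ge0 ?gram_row_ge0 //=.
by rewrite ler_pM ?gram_row_ge0 // lerDl gram_row_ge0.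
Qed.

Lemma hadamard (R : realFieldType) n (M : 'M[R]_n) :
  (forall i j, `|M i j| <= 1) -> \det M ^+ 2 <= n%:R ^+ n.
Proof.
move=> M_le1; have /andP[_] := det_gram_bounds M.
rewrite det_mulmx det_tr -expr2 => /le_trans; apply.
rewrite -[X in _ ^+ X]card_ord -prodr_const; apply: ler_prod => i _.
rewrite sumr_ge0 => [|j _]; last exact: sqr_ge0.
rewrite -[X in _ <= X%:R]card_ord -sumr_const ler_sum // => j _.
by rewrite -real_normK ?num_real // expr_le1.
Qed.

(** * Vertices of a slice of a polyhedral cone *)

(** From [z0], move inside the slice along a direction that keeps tight rows tight and does not
    lower [c], until a further row becomes tight; induct on the number of slack rows. The assumption
    on [d] ensures that every such move is blocked. The vertex reached need not maximise [c]. *)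
Lemma cone_vertex (R : realFieldType) q N (A : 'M[R]_(q, N)) (e c : 'rV[R]_N)
    (z0 : 'cV[R]_N) :
  (forall i, 0 <= (A *m z0) i 0) ->
  (forall d : 'cV_N, e *m d = 0 -> 0 <= (c *m d) 0 0 ->
     (forall i, 0 <= (A *m d) i 0) -> d = 0) ->
  exists z : 'cV_N,
    [/\ forall i, 0 <= (A *m z) i 0, e *m z = e *m z0,
        (c *m z0) 0 0 <= (c *m z) 0 0 &
        forall d : 'cV_N, e *m d = 0 ->
          (forall i, (A *m z) i 0 = 0 -> (A *m d) i 0 = 0) -> d = 0].
Proof.
move=> Az0 pointed.
have [k le_k] := ubnP #|[set i | (A *m z0) i 0 != 0]|.
elim: k z0 Az0 le_k => // k IHk z0 Az0 le_k.
have [extr|] := pselect (forall d : 'cV_N, e *m d = 0 ->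
  (forall i, (A *m z0) i 0 = 0 -> (A *m d) i 0 = 0) -> d = 0); first by exists z0.
move=> /existsNP[d0 /not_implyP[ed0 /not_implyP[td0 d0_neq0]]].
have [d [ed td d_neq0 cd]] : exists d : 'cV_N, [/\ e *m d = 0,
    forall i, (A *m z0) i 0 = 0 -> (A *m d) i 0 = 0, d <> 0 & 0 <= (c *m d) 0 0].
  have [cd0|cd0] := leP 0 ((c *m d0) 0 0); first by exists d0.
  exists (- d0); split.
  - by rewrite mulmxN ed0 oppr0.
  - by move=> i /td0 Ad0; rewrite mulmxN mxE Ad0 oppr0.
  - by move=> /eqP; rewrite oppr_eq0 => /eqP.
  - by rewrite mulmxN mxE oppr_ge0 ltW.
have [i0 Ad_i0] : exists i, (A *m d) i 0 < 0.
  have [/existsP//|/existsPn Ad] := boolP [exists i, (A *m d) i 0 < 0].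
  by case: d_neq0; apply: pointed => // i; rewrite leNgt Ad.
(* Ratio test: [step i] is the length at which a row [i] that decreases along [d] reaches zero. *)
pose step i := (A *m z0) i 0 / - (A *m d) i 0.
have [i1 Ad_i1 min_i1] : exists2 i1, (A *m d) i1 0 < 0 &
    forall i, (A *m d) i 0 < 0 -> step i1 <= step i.
  by case: (@arg_minP _ _ _ i0 (fun i => (A *m d) i 0 < 0) step Ad_i0) => i1;
    exists i1.
have step_ge0 : 0 <= step i1 by rewrite divr_ge0 // oppr_ge0 ltW.
pose z1 := z0 + step i1 *: d.
have Az1E i : (A *m z1) i 0 = (A *m z0) i 0 + step i1 * (A *m d) i 0.
  by rewrite mulmxDr -scalemxAr !mxE.
have Az1 i : 0 <= (A *m z1) i 0.
  rewrite Az1E; have [Ad_i|Ad_i] := leP 0 ((A *m d) i 0).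
    by rewrite addr_ge0 // mulr_ge0.
  rewrite -[X in _ * X]opprK mulrN subr_ge0 -ler_pdivlMr ?oppr_gt0 //.
  exact: min_i1.
have ez1 : e *m z1 = e *m z0 by rewrite mulmxDr -scalemxAr ed scaler0 addr0.
have cz1 : (c *m z0) 0 0 <= (c *m z1) 0 0.
  by rewrite mulmxDr -scalemxAr !mxE lerDl mulr_ge0 //; rewrite mxE in cd.
case: (IHk z1 Az1) => [|z [Az ez cz extr]]; last first.
  by exists z; split; rewrite ?ez // (le_trans cz1).
rewrite -ltnS; apply: leq_trans le_k; rewrite ltnS; apply: proper_card.
apply/properP; split.
  apply/subsetP => i; rewrite !inE; apply: contra_neq => Az0_i.
  by rewrite Az1E Az0_i td // mulr0 addr0.
(* Row [i1] was slack, as tight rows stay constant along [d], and it is tight at [z1]. *)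
exists i1; rewrite !inE.
  by apply: contraTneq Ad_i1 => /td ->; rewrite ltxx.
rewrite negbK Az1E /step invrN mulrN mulNr divfK ?subrr //.
by rewrite lt_eqF.
Qed.

(** The tight rows have rank at most [p], since they kill [z], and at least [p], since adding the
    single row [e] leaves no kernel. *)
Lemma tight_rows (R : realFieldType) q p (A : 'M[R]_(q, 1 + p))
    (e : 'rV[R]_(1 + p)) (z : 'cV[R]_(1 + p)) :
  z != 0 ->
  (forall d : 'cV_(1 + p), e *m d = 0 ->
     (forall i, (A *m z) i 0 = 0 -> (A *m d) i 0 = 0) -> d = 0) ->
  exists B : 'M[R]_(p, 1 + p),
    [/\ row_free B, B *m z = 0 &
        forall i, row i B = 0 \/ exists k, row i B = row k A].
Proof.
move=> z_neq0 extr.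
(* Slack rows are zeroed rather than deleted, so that [T] keeps the row indices of [A]. *)
pose T := \matrix_i (if (A *m z) i 0 == 0 then row i A else 0).
have T_row i (d : 'cV_(1 + p)) :
    (T *m d) i 0 = if (A *m z) i 0 == 0 then (A *m d) i 0 else 0.
  have -> : (T *m d) i 0 = (row i T *m d) 0 0 by rewrite -row_mul [RHS]mxE.
  by rewrite rowK; case: ifP => _; rewrite ?mul0mx -?row_mul mxE.
have Tz : T *m z = 0.
  by apply/colP => i; rewrite T_row [RHS]mxE; case: eqP.
have rank_le : (\rank T <= p)%N.
  have : (z^T <= kermx T^T)%MS by apply/sub_kermxP; rewrite -trmx_mul Tz trmx0.
  move/mxrankS; rewrite mxrank_ker !mxrank_tr -mxrank_tr rank_rV trmx_eq0 z_neq0.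
  by rewrite subn_gt0 ltnS.
have rank_ge : (1 + p <= 1 + \rank T)%N.
  have full : kermx (col_mx e T)^T = 0.
    apply/row_matrixP => i; rewrite row0; apply: trmx_inj; rewrite trmx0.
    have : (col_mx e T) *m (row i (kermx (col_mx e T)^T))^T = 0.
      rewrite -[LHS]trmxK trmx_mul trmxK; apply/eqP; rewrite trmx_eq0.
      by apply/eqP/sub_kermxP; exact: row_sub.
    rewrite mul_col_mx -[0 in RHS]col_mx0 => /eq_col_mx[ed Td].
    apply: extr => // k Az; have := congr1 (fun X : 'cV_q => X k 0) Td.
    by rewrite T_row Az eqxx => ->; rewrite mxE.
  have := mxrank_ker (col_mx e T)^T.
  rewrite full mxrank0 mxrank_tr => /esym/eqP; rewrite subn_eq0 => /leq_trans; apply.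
  rewrite -addsmxE (leq_trans (mxrank_adds_leqif e T)) // leq_add2r.
  exact: rank_leq_row.
have def_p : \rank T = p by apply/eqP; rewrite eqn_leq rank_le -(leq_add2l 1).
have [B freeB [Bz rowsB]] : exists2 B : 'M[R]_(\rank T, 1 + p), row_free B &
    B *m z = 0 /\ forall i, row i B = 0 \/ exists k, row i B = row k A.
  exists (rowsub (maxrankfun T) T); first exact: maxrowsub_free.
  split; first by rewrite mul_rowsub_mx Tz; apply/matrixP => i j; rewrite !mxE.
  move=> i; rewrite row_rowsub rowK; case: ifP => _; last by left.
  by right; exists (maxrankfun T i).
by rewrite def_p in B freeB Bz rowsB *; exists B.
Qed.

(** * Kernels of matrices with one more column than rows *)

(* Cramer's rule for the one-dimensional kernel of [B]. *)
Lemma kernel_cramer (R : fieldType) p (B : 'M[R]_(p, 1 + p)) (z : 'cV[R]_(1 + p))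
    (u : 'rV[R]_(1 + p)) :
  B *m z = 0 ->
  \det (col_mx u B) * z 0 0 = \det (rsubmx B) * (u *m z) 0 0.
Proof.
move=> Bz; pose M : 'M[R]_p.+1 := col_mx u B.
have Mz : M *m z = col_mx (u *m z) 0 by rewrite -Bz -mul_col_mx.
have Mz0 : (M *m z) 0 0 = (u *m z) 0 0.
  by rewrite Mz; have := col_mxEu (u *m z) (0 : 'cV_p) 0 0; rewrite lshift0.
have MzS i : (M *m z) (lift ord0 i) 0 = 0.
  by rewrite Mz; have := col_mxEd (u *m z) 0 i 0; rewrite rshift1 => ->; rewrite mxE.
(* Only the first entry of [M *m z] survives, so entry 0 of this identity involves a single
   cofactor, the minor [\det (rsubmx B)]. *)
have : (\adj M *m M *m z) 0 0 = (\adj M *m (M *m z)) 0 0 by rewrite mulmxA.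
rewrite mul_adj_mx mul_scalar_mx mxE => ->; rewrite mxE big_ord_recl.
rewrite big1 ?addr0 => [|i _]; last by rewrite MzS mulr0.
rewrite Mz0 mxE /cofactor addn0 expr0 mul1r.
congr (\det _ * _).
apply/matrixP => i j; rewrite mxE [RHS]mxE mxE -!rshift1.
exact: col_mxEd.
Qed.

(** If [y] kills every column but the first, then [y *m B *m z = 0] and [z 0 0 != 0] make it kill
    the first as well, against the freeness of the rows. *)
Lemma kernel_minor_neq0 (R : fieldType) p (B : 'M[R]_(p, 1 + p))
    (z : 'cV[R]_(1 + p)) :
  row_free B -> B *m z = 0 -> z 0 0 != 0 -> \det (rsubmx B) != 0.
Proof.
move=> freeB Bz z0_neq0; apply/negP => /det0P[y /negP y_neq0 yB]; apply: y_neq0.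
have : y *m B *m z = 0 by rewrite -mulmxA Bz mulmx0.
rewrite -[B](@hsubmxK _ p 1 p) mul_mx_row yB -[z](@vsubmxK _ 1 p).
rewrite mul_row_col mul0mx addr0 => yBz.
suff yB0 : y *m lsubmx B = 0.
  have := freeB; rewrite -kermx_eq0 => /eqP kerB.
  rewrite -submx0 -kerB; apply/sub_kermxP.
  by rewrite -[B](@hsubmxK _ p 1 p) mul_mx_row yB yB0 row_mx0.
apply/matrixP => i j; rewrite !ord1 [RHS]mxE.
move/matrixP/(_ 0 0): yBz; rewrite mxE big_ord1 [RHS]mxE => /eqP.
by rewrite mulf_eq0 [usubmx z _ _]mxE lshift0 (negPf z0_neq0) orbF => /eqP.
Qed.

(** * Encoding the linear program *)

Lemma dotb_ge0 (R : realType) n (w : 'rV[R]_n) x :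
  (forall i, 0 <= w 0 i) -> 0 <= dotb w x.
Proof. by move=> w_ge0; apply: sumr_ge0 => i _; rewrite mulr_ge0. Qed.

Lemma dotb_le_sum (R : realType) n (w : 'rV[R]_n) x :
  (forall i, 0 <= w 0 i) -> dotb w x <= \sum_i w 0 i.
Proof.
by move=> w_ge0; apply: ler_sum => i _; case: (x i); rewrite ?mulr1 ?mulr0.
Qed.

Lemma dotb_ones (R : realType) n (w : 'rV[R]_n) :
  dotb w [ffun => true] = \sum_i w 0 i.
Proof. by apply: eq_bigr => i _; rewrite ffunE mulr1. Qed.

Lemma dotb_zeros (R : realType) n (w : 'rV[R]_n) : dotb w [ffun => false] = 0.
Proof. by apply: big1 => i _; rewrite ffunE mulr0. Qed.

Lemma dotb_unit (R : realType) n (w : 'rV[R]_n) i :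
  dotb w [ffun j => j == i] = w 0 i.
Proof.
rewrite /dotb (bigD1 i) //= ffunE eqxx mulr1 big1 ?addr0 // => j /negPf ji.
by rewrite ffunE ji mulr0.
Qed.

(* The unknowns are stacked as [(s, theta', h)], where [s] is the total mass of
   the tail, distributed in the fixed proportions [t], and [h] is the head. The
   tail mass comes first so that the only non-integral column is column 0. *)
Definition unstack (R : realType) K m (t : 'rV[R]_m) (z : 'cV[R]_(1 + (1 + K))) :
    'rV[R]_(K + m) :=
  row_mx (dsubmx (dsubmx z))^T (z 0 0 *: t).

Definition threshold (R : realType) K (z : 'cV[R]_(1 + (1 + K))) : R :=
  z (rshift 1 (lshift K 0)) 0.

Definition ineq_row (R : realType) K m (t : 'rV[R]_m)
    (a b : {ffun 'I_(K + m) -> bool}) (c : bool) : 'rV[R]_(1 + (1 + K)) :=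
  row_mx (dotb t [ffun i => a (rshift K i)] - dotb t [ffun i => b (rshift K i)])%:M
    (row_mx (- c%:R)%:M (\row_i ((a (lshift m i))%:R - (b (lshift m i))%:R))).

Lemma dotb_unstack (R : realType) K m (t : 'rV[R]_m) (z : 'cV[R]_(1 + (1 + K))) x :
  dotb (unstack t z) x =
    \sum_i z (rshift 1 (rshift 1 i)) 0 * (x (lshift m i))%:R +
    z 0 0 * dotb t [ffun i => x (rshift K i)].
Proof.
rewrite /dotb big_split_ord /=; congr (_ + _); last rewrite big_distrr /=.
  by apply: eq_bigr => i _; rewrite row_mxEl !mxE.
by apply: eq_bigr => i _; rewrite row_mxEr mxE ffunE mulrA.
Qed.

Lemma mul_ineq_row (R : realType) K m (t : 'rV[R]_m) a b c
    (z : 'cV[R]_(1 + (1 + K))) :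
  (ineq_row t a b c *m z) 0 0 =
    dotb (unstack t z) a - dotb (unstack t z) b - c%:R * threshold z.
Proof.
rewrite !dotb_unstack mxE !big_split_ord /= !big_ord1.
rewrite row_mxEl row_mxEr row_mxEl !mxE !eqxx !mulr1n lshift0 -/(threshold z).
under eq_bigr do rewrite row_mxEr row_mxEr mxE mulrBl ![_%:R * z _ _]mulrC.
rewrite big_split /= sumrN; ring.
Qed.

Lemma sum_unstack (R : realType) K m (t : 'rV[R]_m) (z : 'cV[R]_(1 + (1 + K))) :
  \sum_i t 0 i = 1 ->
  \sum_i unstack t z 0 i = \sum_i z (rshift 1 (rshift 1 i)) 0 + z 0 0.
Proof.
move=> t1; rewrite -dotb_ones dotb_unstack; congr (_ + _).
  by apply: eq_bigr => i _; rewrite ffunE mulr1.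
rewrite (_ : [ffun _ => _] = [ffun => true]) ?dotb_ones ?t1 ?mulr1 //.
by apply/ffunP => i; rewrite !ffunE.
Qed.

Lemma ineq_row_le1 (R : realType) K m (t : 'rV[R]_m) a b c (j : 'I_(1 + (1 + K))) :
  (forall i, 0 <= t 0 i) -> \sum_i t 0 i = 1 -> `|ineq_row t a b c 0 j| <= 1.
Proof.
move=> t_ge0 t1; rewrite -[j](@splitK 1); case: split => {}j /=.
  rewrite row_mxEl mxE ord1 eqxx mulr1n ler_norml.
  have dot_ge0 x := dotb_ge0 x t_ge0.
  have dot_le1 x : dotb t x <= 1 by rewrite -t1 dotb_le_sum.
  apply/andP; split; first by rewrite lerNl opprB lerBlDr (le_trans (dot_le1 _)) // lerDl.
  by rewrite lerBlDr (le_trans (dot_le1 _)) // lerDl.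
rewrite row_mxEr -[j](@splitK 1); case: split => {}j /=.
  by rewrite row_mxEl mxE ord1 eqxx mulr1n normrN; case: c; rewrite ?normr1 ?normr0.
rewrite row_mxEr mxE.
by case: (a _) (b _) => [] []; rewrite ?subrr ?subr0 ?sub0r ?normrN ?normr0 ?normr1.
Qed.

Lemma ineq_row_int (R : realType) K m (t : 'rV[R]_m) a b c (j : 'I_(1 + K)) :
  ineq_row t a b c 0 (rshift 1 j) \is a Num.int.
Proof.
rewrite row_mxEr -[j](@splitK 1); case: split => {}j /=.
  by rewrite row_mxEl mxE ord1 eqxx mulr1n rpredN natr_int.
by rewrite row_mxEr mxE rpredB ?natr_int.
Qed.

(** * Determinant estimates and compression of the tail *)

Lemma det_int (R : realType) n (M : 'M[R]_n) :
  (forall i j, M i j \is a Num.int) -> \det M \is a Num.int.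
Proof.
move=> M_int; apply: rpred_sum => s _.
by rewrite rpredM ?rpredX ?rpredN ?rpred1 ?rpred_prod.
Qed.

Lemma hadamard_powR (R : realType) n (M : 'M[R]_n) :
  (forall i j, `|M i j| <= 1) -> `|\det M| <= n%:R `^ (n%:R / 2).
Proof.
move=> M_le1; rewrite -(@ler_pXn2r _ 2) ?nnegrE ?powR_ge0 //.
rewrite real_normK ?num_real // (le_trans (hadamard M_le1)) //.
by rewrite -[_ ^+ 2]powR_mulrn ?powR_ge0 // -powRrM divfK ?pnatr_eq0 // powR_mulrn.
Qed.

(** Preserving the whole family of inequalities in [a], [b], [c] yields monotonicity, nonnegativity
    and the bound on the halfspace at once, by taking unit vectors, zero or a point of the
    halfspace. *)
Lemma compress_tail (R : realType) K m (theta : R) (w : 'rV[R]_(K + m)) :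
  (forall i, 0 <= w 0 i) -> \sum_i w 0 i = 1 -> theta <= 1 ->
  0 < \sum_i w 0 (rshift K i) ->
  exists (v : 'rV[R]_(K + m)) (theta' : R),
    [/\ theta <= theta', \sum_i v 0 i = 1,
        forall a b (c : bool), dotb w b + c%:R * theta <= dotb w a ->
          dotb v b + c%:R * theta' <= dotb v a &
        (forall i, v 0 (rshift K i) = 0) \/
        \sum_i v 0 (lshift m i) <=
          K.+2%:R `^ (K.+2%:R / 2) * \sum_i v 0 (rshift K i)].
Proof.
move=> w_ge0 w1 theta_le1; set W := \sum_i _ => W_gt0.
pose t : 'rV[R]_m := W^-1 *: rsubmx w.
have t_ge0 i : 0 <= t 0 i by rewrite !mxE mulr_ge0 // invr_ge0 ltW.
have t1 : \sum_i t 0 i = 1.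
  rewrite -(@mulVf _ W) ?gt_eqF // big_distrr /=.
  by apply: eq_bigr => i _; rewrite !mxE.
pose valid := [set q : {ffun 'I_(K + m) -> bool} * {ffun 'I_(K + m) -> bool} * bool |
  dotb w q.1.2 + q.2%:R * theta <= dotb w q.1.1].
pose A := \matrix_(k < #|valid|)
  let q := enum_val k in ineq_row t q.1.1 q.1.2 q.2.
have AE z k : (A *m z) k 0 = let q := enum_val k in
    dotb (unstack t z) q.1.1 - dotb (unstack t z) q.1.2 - q.2%:R * threshold z.
  have -> : (A *m z) k 0 = (row k A *m z) 0 0 by rewrite -row_mul [RHS]mxE.
  by rewrite rowK mul_ineq_row.
have A_ge0 z : (forall k, 0 <= (A *m z) k 0) ->
    forall a b (c : bool), dotb w b + c%:R * theta <= dotb w a ->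
      dotb (unstack t z) b + c%:R * threshold z <= dotb (unstack t z) a.
  move=> Az a b c abc; have q_valid : (a, b, c) \in valid by rewrite inE.
  have := Az (enum_rank_in q_valid (a, b, c)).
  by rewrite AE enum_rankK_in //= -addrA -opprD subr_ge0.
(* The starting point encodes [w] and [theta] themselves. *)
pose z0 : 'cV[R]_(1 + (1 + K)) := col_mx W%:M (col_mx theta%:M (lsubmx w)^T).
have z0_0 : z0 0 0 = W.
  have := col_mxEu W%:M (col_mx theta%:M (lsubmx w)^T) 0 0.
  by rewrite lshift0 [RHS]mxE eqxx mulr1n.
have z0_unstack : unstack t z0 = w.
  rewrite /unstack z0_0 !col_mxKd trmxK -[RHS]hsubmxK; congr (row_mx _ _).
  by rewrite scalerA divff ?gt_eqF // scale1r.
have z0_threshold : threshold z0 = theta.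
  by rewrite /threshold col_mxEd col_mxEu mxE eqxx.
pose e : 'rV[R]_(1 + (1 + K)) := row_mx 1 (row_mx 0 (const_mx 1)).
pose obj : 'rV[R]_(1 + (1 + K)) := row_mx 0 (row_mx 1 0).
have eE (z : 'cV_(1 + (1 + K))) : (e *m z) 0 0 = \sum_i unstack t z 0 i.
  rewrite sum_unstack // mxE !big_split_ord /= !big_ord1 addrC.
  rewrite row_mxEl row_mxEr row_mxEl !mxE mul1r mul0r add0r lshift0.
  by congr (_ + _); apply: eq_bigr => i _; rewrite !row_mxEr mxE mul1r.
have objE (z : 'cV_(1 + (1 + K))) : (obj *m z) 0 0 = threshold z.
  rewrite mxE !big_split_ord /= !big_ord1.
  rewrite row_mxEl row_mxEr row_mxEl !mxE mul1r mul0r add0r big1 ?addr0 // => i _.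
  by rewrite !row_mxEr mxE mul0r.
have nonneg v' : (forall a b (c : bool), dotb w b + c%:R * theta <= dotb w a ->
      dotb (unstack t v') b + c%:R * threshold v' <= dotb (unstack t v') a) ->
    forall i, 0 <= unstack t v' 0 i.
  move=> Hv i; have := Hv [ffun j => j == i] [ffun => false] false.
  by rewrite !dotb_zeros !dotb_unit !mul0r !addr0; apply.
have Az0 k : 0 <= (A *m z0) k 0.
  rewrite AE /= z0_unstack z0_threshold -addrA -opprD subr_ge0.
  by have := enum_valP k; rewrite inE.
have pointed (d : 'cV_(1 + (1 + K))) : e *m d = 0 -> 0 <= (obj *m d) 0 0 ->
    (forall i, 0 <= (A *m d) i 0) -> d = 0.
  move=> ed; rewrite objE => th_ge0 /A_ge0 Ad.
  have d_ge0 := nonneg _ Ad.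
  have sum0 : \sum_i unstack t d 0 i = 0 by rewrite -eE ed mxE.
  have d0 i : unstack t d 0 i = 0.
    by apply: (psumr_eq0P _ sum0) => // j _; exact: d_ge0.
  have th0 : threshold d = 0.
    apply/eqP; rewrite eq_le th_ge0 andbT.
    (* As [theta <= 1], the family contains the inequality between the total mass and the threshold;
       the mass of [d] is zero. *)
    have := Ad [ffun => true] [ffun => false] true.
    by rewrite !dotb_zeros !dotb_ones sum0 w1 !mul1r !add0r => ->.
  have h0 i : d (rshift 1 (rshift 1 i)) 0 = 0.
    by have := d0 (lshift m i); rewrite row_mxEl !mxE.
  have s0 : d 0 0 = 0.
    by move: sum0; rewrite sum_unstack // big1 ?add0r.
  apply/colP => j; rewrite mxE -[j](@splitK 1); case: split => {}j /=.
    by rewrite ord1 lshift0.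
  by rewrite -[j](@splitK 1); case: split => {}j /=; rewrite ?ord1.
have [z [/A_ge0 Az ez objz extr]] := cone_vertex Az0 pointed.
have z1 : \sum_i unstack t z 0 i = 1 by rewrite -eE ez eE z0_unstack.
have z_neq0 : z != 0.
  apply/eqP => z0E; move: z1; rewrite -eE z0E mulmx0 mxE => /eqP.
  by rewrite eq_sym oner_eq0.
have [B [freeB Bz rowsB]] := tight_rows z_neq0 extr.
exists (unstack t z), (threshold z); split => //.
  by move: objz; rewrite !objE z0_threshold.
have head i : unstack t z 0 (lshift m i) = z (rshift 1 (rshift 1 i)) 0.
  by rewrite row_mxEl !mxE.
have tail i : unstack t z 0 (rshift K i) = z 0 0 * t 0 i by rewrite row_mxEr mxE.
have [s0|s_neq0] := eqVneq (z 0 0) 0; [left => i|right].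
  by rewrite tail s0 mul0r.
have sum_tail : \sum_i unstack t z 0 (rshift K i) = z 0 0.
  by under eq_bigr do rewrite tail; rewrite -big_distrr /= t1 mulr1.
have z_ge0 := nonneg _ Az.
(* [u] selects the head sum, the numerator in Cramer's rule. *)
pose u : 'rV[R]_(1 + (1 + K)) := row_mx 0 (row_mx 0 (const_mx 1)).
have uz : (u *m z) 0 0 = \sum_i unstack t z 0 (lshift m i).
  rewrite mxE !big_split_ord /= !big_ord1.
  rewrite row_mxEl row_mxEr row_mxEl !mxE !mul0r !add0r.
  by apply: eq_bigr => i _; rewrite !row_mxEr mxE mul1r head.
have B_entry i j : `|B i j| <= 1 /\
    forall j', j = rshift 1 j' -> B i j \is a Num.int.
  have -> : B i j = row i B 0 j by rewrite mxE.
  case: (rowsB i) => [->|[k ->]].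
    by rewrite mxE normr0 ler01; split=> // j' _; rewrite rpred0.
  rewrite rowK; split=> [|j' ->]; first exact: ineq_row_le1.
  exact: ineq_row_int.
have minor_ge1 : 1 <= `|\det (rsubmx B)|.
  apply: norm_intr_ge1 (kernel_minor_neq0 freeB Bz s_neq0).
  by apply: det_int => i j; rewrite mxE; have [_] := B_entry i (rshift 1 j); apply.
have det_le : `|\det (col_mx u B)| <= K.+2%:R `^ (K.+2%:R / 2).
  apply: hadamard_powR => i j; rewrite -[i](@splitK 1); case: split => {}i /=.
    rewrite col_mxEu -[j](@splitK 1); case: split => {}j /=.
      by rewrite row_mxEl mxE normr0.
    rewrite row_mxEr -[j](@splitK 1); case: split => {}j /=.
      by rewrite row_mxEl mxE normr0.
    by rewrite row_mxEr mxE normr1.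
  by rewrite col_mxEd; have [] := B_entry i j.
have s_ge0 : 0 <= z 0 0 by rewrite -sum_tail sumr_ge0.
have h_ge0 : 0 <= \sum_i unstack t z 0 (lshift m i) by rewrite sumr_ge0.
rewrite sum_tail.
(* The head sum is at most its product with the minor, which Cramer's rule equates with [z 0 0]
   times the bounded determinant. *)
apply: (@le_trans _ _ (`|\det (rsubmx B)| * \sum_i unstack t z 0 (lshift m i))).
  by rewrite ler_peMl.
rewrite -(ger0_norm h_ge0) -normrM -uz -(kernel_cramer u Bz) normrM (ger0_norm s_ge0).
by rewrite ler_wpM2r.
Qed.

(* Indices are 0-based: the coordinates 1, ..., K of the text are the
   i : 'I_n with i < K, and K+1, ..., n are those with K <= i. *)
Theorem theorem4 (R : realType) (n K : nat) (hK : (1 <= K <= n)%N)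
    (theta : R) (htheta : 0 < theta < 1)
    (w : 'rV[R]_n) (hw : nonincreasing_ge0 w)
    (hw1 : \sum_(i < n) w ord0 i = 1) :
  exists v : 'rV[R]_n,
    [/\ \sum_(i < n) v ord0 i = 1 /\ nonincreasing_ge0 v,
        (forall x : {ffun 'I_n -> bool},
            x \in halfspace w theta -> theta <= dotb v x) &
        (forall i : 'I_n, (K <= i)%N -> v ord0 i = 0) \/
        \sum_(i < n | (i < K)%N) v ord0 i <=
          (K.+2%:R `^ (K.+2%:R / 2)) * \sum_(i < n | (K <= i)%N) v ord0 i].
Proof.
have {hK} [m def_n] : exists m, n = (K + m)%N.
  by case/andP: hK => _ leKn; exists (n - K)%N; rewrite subnKC.
subst n; have [w_dec w_ge0] := hw.
have tail_idx (v : 'rV[R]_(K + m)) : (forall i, v 0 (rshift K i) = 0) ->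
    forall i : 'I_(K + m), (K <= i)%N -> v ord0 i = 0.
  move=> v0 i; rewrite -[i]splitK; case: split => {}i //=.
  by rewrite leqNgt ltn_ord.
have : 0 <= \sum_i w 0 (rshift K i) by apply: sumr_ge0.
rewrite le_eqVlt => /orP[/eqP/esym W0|W_gt0].
  (* With zero tail mass the tail proportions are undefined, but [w] itself qualifies. *)
  exists w; split => //; first by move=> x; rewrite inE.
  left; apply: tail_idx => i.
  by apply: (psumr_eq0P _ W0) => // j _; exact: w_ge0.
have theta_le1 : theta <= 1 by case/andP: htheta => _ /ltW.
have [v [theta' [le_theta v1 Hv bound]]] := compress_tail w_ge0 hw1 theta_le1 W_gt0.
exists v; split.
- split=> //; split=> [i j le_ij|i].
    have := Hv [ffun k => k == i] [ffun k => k == j] false.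
    by rewrite !dotb_unit !mul0r !addr0; apply; exact: w_dec.
  have := Hv [ffun k => k == i] [ffun => false] false.
  by rewrite !dotb_zeros !dotb_unit !mul0r !addr0; apply.
- move=> x; rewrite inE => wx.
  (* Only here is [c] true: this gives [theta' <= dotb v x], and [theta <= theta']. *)
  have := Hv x [ffun => false] true; rewrite !dotb_zeros !mul1r !add0r => /(_ wx).
  exact: le_trans.
case: bound => [/tail_idx|bound]; [by left|right].
suff [-> ->] : \sum_(i < K + m | (i < K)%N) v 0 i = \sum_i v 0 (lshift m i) /\
  \sum_(i < K + m | (K <= i)%N) v 0 i = \sum_i v 0 (rshift K i) by [].
rewrite !big_split_ord /=; split.
  rewrite [X in _ + X]big_pred0 => [|i]; last by rewrite ltnNge leq_addr.
  by rewrite addr0; apply: eq_bigl => i; rewrite ltn_ord.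
rewrite [X in X + _]big_pred0 => [|i]; last by rewrite leqNgt ltn_ord.
by rewrite add0r; apply: eq_bigl => i; rewrite leq_addr.
Qed.
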